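(* Let $X=\{0,1,\ldots,K\}$ and $Y=\{\{0\},(0,1),\{1\},(1,2),\ldots,\{K-1\},(K-1,K),\{K\}\}$. For each $n$, let $f_n:X^n\to Y$ map $(x_1,\ldots,x_n)$ to the unique element of $Y$ that contains the average $\frac1n\sum_{i=1}^n x_i$. Then the function family $(f_n)_{n=1,2,\ldots}$ (the interval-averaging family) is computable.
   Context: Here $(a,b)$ denotes an open interval, so the elements of $Y$ are singletons and open unit intervals. Model of computation. $X$ is a finite input set and $Y$ a finite output set. A network is a triple $(n,G,\mathcal L)$ where $n\ge 2$ is the number of nodes, $G=(V,E)$ is a connected bidirectional graph on $V=\{1,\ldots,n\}$ (a directed graph without self-loops such that $(i,j)\in E$ implies $(j,i)\in E$), $d(i)$ is the degree of node $i$ (its in-degree, equal to its out-degree), and $\mathcal L$ is a port labeling: it assigns to the outgoing edges of each node $i$ distinct integers (port numbers) from $\{0,1,\ldots,d(i)\}$. An algorithm is a family of finite automata $(A_d)_{d=1,2,\ldots}$. A state of $A_d$ is a tuple $[x,z,y;(m_1,\ldots,m_d)]$ with $x\in X$ (initial value), $z\in Z_d$ (internal memory state), $y\in Y$ (output), $m_1,\ldots,m_d\in M$ (outgoing messages). The sets $Z_d$ (which may depend on $d$) and $M$ are finite. The sets $Y,Z_d,M$ are assumed to contain a special symbol $\emptyset$ (adjoined if necessary). $A_d$ is identified with a map from $X\times Z_d\times Y\times M^d$ to itself that does not change $x$. Execution: given initial values $x_1,\ldots,x_n\in X$, node $i$ runs $A_{d(i)}$ started at time $0$ with $x=x_i$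 and $z=y=m_1=\cdots=m_{d(i)}=\emptyset$. At each node, order the outgoing edges by increasing port number. Let $j_k$ be the node at the other end of the $k$th outgoing edge of $i$, and let $p_k$ be the position of the edge $(j_k,i)$ in the ordering at $j_k$. For $t=0,1,2,\ldots$ all nodes simultaneously update $$[x_i,z_i(t+1),y_i(t+1);m_{i,1}(t+1),\ldots,m_{i,d(i)}(t+1)]=A_{d(i)}[x_i,z_i(t),y_i(t);m_{j_1,p_1}(t),\ldots,m_{j_{d(i)},p_{d(i)}}(t)].$$ The algorithm terminates with final output $y^*\in Y$ if there is a time $t'$ with $y_i(t)=y^*$ for all nodes $i$ and all $t\ge t'$. A family $(f_n)$, $f_n:X^n\to Y$, is computable if there is an algorithm $(A_d)$ (not depending on $n$ or the network) such that for every $n$, every network $(n,G,\mathcal L)$ and all initial values $x_1,\ldots,x_n\in X$ the algorithm terminates with final output $f_n(x_1,\ldots,x_n)$. *)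

(* Defs.v *)
From HB Require Import structures.
From mathcomp Require Import all_boot all_order all_algebra.

Set Implicit Arguments.
Unset Strict Implicit.
Unset Printing Implicit Defensive.

Import Order.TTheory GRing.Theory Num.Theory.

Record network (n : nat) := Network {
  edge : rel 'I_n;
  edge_irr : irreflexive edge;
  edge_sym : symmetric edge;
  edge_conn : forall i j, connect edge i j;
  (* [port i j] is meaningful only when [edge i j]; degrees count out-edges. *)
  port : 'I_n -> 'I_n -> nat;
  port_le : forall i j, edge i j -> port i j <= #|edge i|;
  port_inj : forall i j k,
    edge i j -> edge i k -> port i j = port i k -> j = k
}.

Section Network.
Variables (n : nat) (N : network n).

Definition degree (i : 'I_n) : nat := #|edge N i|.

(* The heads j_1, j_2, ... of the out-edges of i, by increasing port number;
   positions are counted from 0. *)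
Definition neighbours (i : 'I_n) : (degree i).-tuple 'I_n :=
  [tuple of sort (relpre (port N i) leq) (enum_tuple (edge N i))].

Definition position (j i : 'I_n) : nat := index i (neighbours j).

Lemma position_lt (j i : 'I_n) : edge N i j -> position j i < degree j.
Proof.
rewrite edge_sym => ji; rewrite -[degree j](size_tuple (neighbours j)).
by rewrite index_mem mem_sort mem_enum.
Qed.

End Network.

(* The symbol "emptyset" adjoined to the memory, output and message sets
   is [None]. *)
Record state (X Y M Z : Type) (d : nat) := State {
  st_init : X;
  st_mem : option Z;
  st_out : option Y;
  st_msg : d.-tuple (option M)
}.

Record algorithm (X Y : finType) := Algorithm {
  memory : nat -> finType;
  message : finType;
  automaton : forall d,
    state X Y message (memory d) d -> state X Y message (memory d) d;
  automaton_init : forall d s, st_init (@automaton d s) = st_init s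
}.

Section Execution.
Variables (X Y : finType) (A : algorithm X Y) (n : nat) (N : network n).

Definition node_state (i : 'I_n) : Type :=
  state X Y (message A) (memory A (degree N i)) (degree N i).

(* The default of [nth] is never reached, by [position_lt]. *)
Definition incoming (c : forall i, node_state i) (i : 'I_n) :
    (degree N i).-tuple (option (message A)) :=
  [tuple of [seq nth None (st_msg (c j)) (position N j i)
            | j <- neighbours N i]].

Fixpoint run (x : {ffun 'I_n -> X}) (t : nat) : forall i, node_state i :=
  match t with
  | 0 => fun i => State (x i) None None [tuple of nseq (degree N i) None]
  | t'.+1 => fun i =>
      automaton (State (x i) (st_mem (run x t' i)) (st_out (run x t' i))
                       (incoming (run x t') i))
  end.

Definition terminates_with (x : {ffun 'I_n -> X}) (y : Y) : Prop :=
  exists t', forall t, t' <= t -> forall i, st_out (run x t i) = Some y.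

End Execution.

Definition computable (X Y : finType)
    (f : forall n, {ffun 'I_n -> X} -> Y) : Prop :=
  exists A : algorithm X Y,
    forall n, 2 <= n -> forall (N : network n) (x : {ffun 'I_n -> X}),
      terminates_with A N x (f n x).

Local Open Scope ring_scope.

Definition unit_intervals (K : nat) : seq (interval rat) :=
  [seq `[k%:R, k%:R] | k <- iota 0 K.+1] ++
  [seq `]k%:R, k.+1%:R[ | k <- iota 0 K].

Definition output (K : nat) : finType := seq_sub (unit_intervals K).

Definition average (K n : nat) (x : {ffun 'I_n -> 'I_K.+1}) : rat :=
  (\sum_i (x i)%:R) / n%:R.

Lemma average_bounds (K n : nat) (x : {ffun 'I_n -> 'I_K.+1}) :
  0 <= average x <= K%:R.
Proof.
rewrite /average -natr_sum divr_ge0 ?ler0n //=.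
case: n x => [|n] x; first by rewrite invr0 mulr0 ler0n.
rewrite ler_pdivrMr ?ltr0n // -natrM ler_nat.
rewrite -[X in (_ <= _ * X)%N]card_ord mulnC -sum_nat_const leq_sum // => i _.
by rewrite -ltnS.
Qed.

Lemma mem_unit_intervals (K : nat) (I : interval rat) :
  I \in unit_intervals K ->
  exists k : nat, I = `[k%:R, k%:R] \/ I = `]k%:R, k.+1%:R[.
Proof.
by rewrite mem_cat => /orP[] /mapP[k _ ->]; exists k; [left|right].
Qed.

Lemma unit_intervals_inj (K : nat) (I J : interval rat) (r : rat) :
  I \in unit_intervals K -> J \in unit_intervals K ->
  r \in I -> r \in J -> I = J.
Proof.
move=> /mem_unit_intervals[k Ik] /mem_unit_intervals[l Jl].
case: Ik Jl => -> [] ->; rewrite !in_itv /=.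
- by rewrite -!eq_le => /eqP <- /eqP ->.
- rewrite -eq_le => /eqP <-.
  by rewrite !ltr_nat ltnS => /andP[/leq_trans h /h]; rewrite ltnn.
- move=> h; rewrite -eq_le => /eqP E; move: h; rewrite -E.
  by rewrite !ltr_nat ltnS => /andP[/leq_trans h /h]; rewrite ltnn.
- move=> /andP[kr rk] /andP[lr rl].
  suff -> : k = l by [].
  have kl : (k < l.+1)%N by rewrite -(ltr_nat rat) (lt_trans kr rl).
  have lk : (l < k.+1)%N by rewrite -(ltr_nat rat) (lt_trans lr rk).
  by apply/eqP; rewrite eqn_leq -ltnS kl -ltnS lk.
Qed.

Lemma average_unique (K n : nat) (x : {ffun 'I_n -> 'I_K.+1}) :
  exists! y : output K, average x \in ssval y.
Proof.
have /andP[r0 rK] := average_bounds x; set r := average x in r0 rK *.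
suff [I IK rI] : exists2 I, I \in unit_intervals K & r \in I.
  exists (SeqSub IK); split=> // y ry; apply: val_inj.
  exact: (unit_intervals_inj IK (valP y) rI ry).
have /andP[lo hi] := Num.Theory.truncn_itv r0; set k := Num.truncn r in lo hi.
have kK : (k <= K)%N by rewrite -(ler_nat rat) (le_trans lo rK).
have [rk|rk] := eqVneq r k%:R.
  exists `[k%:R, k%:R]; last by rewrite in_itv /= rk lexx.
  by rewrite mem_cat map_f // mem_iota ltnS kK.
exists `]k%:R, k.+1%:R[; last by rewrite in_itv /= hi lt_neqAle eq_sym rk lo.
rewrite mem_cat orbC map_f // mem_iota add0n -(ltr_nat rat).
by rewrite (lt_le_trans _ rK) // lt_neqAle eq_sym rk lo.
Qed.

Lemma average_exists (K n : nat) (x : {ffun 'I_n -> 'I_K.+1}) :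
  exists y : output K, average x \in ssval y.
Proof. by have [y [ry _]] := average_unique x; exists y. Qed.

Definition interval_average (K n : nat) (x : {ffun 'I_n -> 'I_K.+1}) :
  output K := xchoose (average_exists x).

(* Main.v *)
Require Import Defs.
From mathcomp Require Import all_boot all_order all_algebra.
From mathcomp Require Import zify.
From Stdlib Require Import Classical.

(** Whether the average lies above a cut of the line (at an integer k, with k
    itself counted above or below the cut) is the sign of a sum of integers,
    one held by each node, and the interval containing the average is read off
    from these finitely many signs. It remains to find the sign of a sum with
    bounded memory, and for this a node with positive value holds that many
    chips, and a node with negative value that much debt.

    Chips walk and debts stay. A node sends its chips out through its ports in
    cyclic order (a rotor-router walk), and a chip that arrives at a debt is
    annihilated together with one unit of it. A node that acts infinitely often
    uses each of its ports infinitely often, so, the graph being connected,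
    walkers that never die out visit every node infinitely often
    ([walk_dichotomy]). Hence chips and debt cannot both survive. Chips minus
    debt is conserved ([balance]), so chips survive exactly when the sum is
    positive, and then every node sees them infinitely often; otherwise every
    node sees them finitely often. Memory stays bounded because a node with at
    least as many chips as ports sends one through every port, which offsets
    whatever it can receive.

    Such a test announces success for ever, but failure only by silence. A node
    turns silence into an answer by running the opposite test as well, and
    believing whichever of the two it heard last. For this exactly one of the
    two must survive, which requires a test that survives a zero sum. A second
    kind of walker, the marks, serves this purpose. A mark is born where a debt
    has just been paid off, is destroyed at any remaining debt, and merges with
    the marks that it meets. If the sum is zero then the last debt to be paid
    leaves a mark that nothing can destroy ([mark_exists]); if the sum is
    negative then some debt remains for ever, no mark is born from some time
    on, and the marks are destroyed one after the other ([marks_vanish]).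
    This gives [active_spec], from which the beliefs, hence the outputs, become
    constant and correct. *)

Set Implicit Arguments.
Unset Strict Implicit.
Unset Printing Implicit Defensive.

(** * Eventual and recurrent properties of time *)
Section Eventually.

Definition eventually (P : nat -> Prop) := exists T, forall t, T <= t -> P t.
Definition recurrent (P : nat -> Prop) := forall T, exists2 t, T <= t & P t.

Lemma not_recurrent (P : nat -> Prop) :
  ~ recurrent P -> eventually (fun t => ~ P t).
Proof.
move=> /not_all_ex_not[T hT]; exists T => t Tt Pt.
by apply: hT; exists t.
Qed.

(** Finiteness of the index type gives a common starting time. *)
Lemma eventually_all (I : finType) (P : I -> nat -> Prop) :
  (forall i, eventually (P i)) -> eventually (fun t => forall i, P i t).
Proof.
move=> /fin_all_exists[T hT]; exists (\max_i T i) => t Tt i.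
by apply: hT; apply: leq_trans Tt; apply: leq_bigmax.
Qed.

Lemma eventually_constant (f : nat -> nat) T :
  (forall t, T <= t -> f t.+1 <= f t) ->
  exists m, eventually (fun t => f t = m).
Proof.
have [k] := ubnP (f T); elim: k T => [//|k IH] T fT fle.
have [[t Tt ft]|none] := classic (exists2 t, T <= t & f t < f T).
  apply: (IH t) => [|u tu]; first exact: leq_trans ft _.
  by apply: fle; apply: leq_trans tu.
exists (f T), T => t Tt; apply/eqP; rewrite eqn_leq; apply/andP; split.
  rewrite -(subnKC Tt); elim: (t - T) => [|u IHu]; first by rewrite addn0.
  by rewrite addnS; apply: leq_trans IHu; apply: fle; apply: leq_addr.
by rewrite leqNgt; apply/negP => ft; apply: none; exists t.
Qed.

End Eventually.

(** * Walks on a network *)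
Section Network.
Variables (n : nat) (N : network n).

Lemma neighbours_uniq i : uniq (neighbours N i).
Proof. by rewrite sort_uniq enum_uniq. Qed.

Lemma mem_neighbours i j : (j \in neighbours N i) = edge N i j.
Proof. by rewrite mem_sort mem_enum. Qed.

Lemma big_neighbours i (F : 'I_n -> nat) :
  \sum_(j <- neighbours N i) F j = \sum_(j | edge N i j) F j.
Proof.
rewrite (perm_big (enum (edge N i))) ?big_enum //=.
by rewrite perm_sort.
Qed.

(** The ports of a node and its neighbours are two enumerations of the same
    edges; chips are sent along ports and counted along edges. *)
Lemma big_position i (F : nat -> nat) :
  \sum_(q < degree N i) F q = \sum_(j | edge N i j) F (position N i j).
Proof.
rewrite -(big_neighbours i (fun j => F (position N i j))) big_tuple.
apply: eq_bigr => q _; congr F.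
by rewrite /position (tnth_nth (tnth (neighbours N i) q))
  index_uniq ?size_tuple ?neighbours_uniq.
Qed.

Lemma position_ltn i j : edge N i j -> position N i j < degree N i.
Proof. by rewrite edge_sym => /position_lt. Qed.

Lemma degree_gt0 i : 1 < n -> 0 < degree N i.
Proof.
move=> n1; have [j ij] : exists j, j != i.
  have lt := ltn_ord i.
  have [/eqP i0|i0] := boolP (i == Ordinal (ltnW n1)).
    by exists (Ordinal n1); rewrite i0.
  by exists (Ordinal (ltnW n1)); rewrite eq_sym.
have /connectP[[|k p] /=] := edge_conn N i j.
  by move=> _ e; rewrite e eqxx in ij.
move=> /andP[ik _] _; rewrite /degree; apply/card_gt0P.
by exists k.
Qed.

Lemma recurrent_connected (a : nat -> 'I_n -> bool) i :
  (forall j k, edge N j k ->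
     recurrent (fun t => a t j) -> recurrent (fun t => a t k)) ->
  recurrent (fun t => a t i) -> forall j, recurrent (fun t => a t j).
Proof.
move=> ae ai j; have /connectP[p pth ->] := edge_conn N i j.
elim: p i ai pth => [//|k p IH] i ai /= /andP[ik]; apply: IH.
exact: ae ik ai.
Qed.

(** A rotor moves on only when it is used. *)
Definition turn (d : nat) (on : bool) (r : nat) := if on then r.+1 %% d else r.

(** Between two uses the rotor stands still, so the successive uses find it at
    successive positions modulo [d]. *)
Lemma turn_recurrent d (on : nat -> bool) (r : nat -> nat) :
  (forall t, r t < d) -> (forall t, r t.+1 = turn d (on t) (r t)) ->
  recurrent on -> forall q, q < d -> recurrent (fun t => on t /\ r t = q).
Proof.
move=> rd rS onR q qd.
(* The first use from time [T] on finds the rotor where it was at [T]. *)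
have next T : exists2 t, T <= t & on t /\ r t = r T.
  have [t Tt ont] := onR T; rewrite -(subnKC Tt) in ont.
  move: (t - T) ont => k {t Tt}; elim: k T => [|k IH] T.
    by rewrite addn0; exists T.
  case onT: (on T); first by exists T.
  rewrite addnS -addSn => /IH[u Tu [onu ru]].
  by exists u; [exact: ltnW | rewrite ru rS /turn onT].
have steps k T : exists2 t, T <= t & on t /\ r t = (r T + k) %% d.
  elim: k => [|k [t Tt [ont rt]]].
    by have [t Tt [ont rt]] := next T; exists t => //; rewrite addn0 modn_small.
  have [u tu [onu ru]] := next t.+1.
  exists u; first by lia.
  by rewrite ru rS /turn ont rt -addn1 modnDml addn1 addnS.
move=> T; have [t Tt [ont rt]] := steps (q + (d - r T)) T.
exists t => //; split=> //; rewrite rt addnCA subnKC ?modnDr ?modn_small //.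
exact: ltnW.
Qed.

(** If the walkers do not die out, some node is visited infinitely often; its
    rotor then sends walkers infinitely often to each neighbour, and the graph
    is connected. The third premise says that a walker which follows the rotor
    is not lost; it is asked only from some time on, since walkers are
    destroyed until the debts have settled. *)
Lemma walk_dichotomy (a : nat -> 'I_n -> bool) (r : nat -> 'I_n -> nat) :
  (forall t i, r t i < degree N i) ->
  (forall t i, r t.+1 i = turn (degree N i) (a t i) (r t i)) ->
  eventually (fun t => forall i j, edge N i j ->
    a t i -> r t i = position N i j -> a t.+1 j) ->
  eventually (fun t => forall i, ~~ a t i) \/
  forall i, recurrent (fun t => a t i).
Proof.
move=> rd rS [T step].
have [[i ai]|none] := classic (exists i, recurrent (fun t => a t i)).
  right; apply: recurrent_connected ai => j k jk aj U.
  have [t Ut [ajt rjt]] := turn_recurrent (rd^~ j) (rS^~ j) aj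
    (position_ltn jk) (maxn T U).
  exists t.+1; first by lia.
  by apply: step ajt rjt => //; lia.
left; apply: eventually_all => i.
have [|U hU] := @not_recurrent (fun t => a t i).
  by move=> ai; apply: none; exists i.
by exists U => t /hU/negP.
Qed.

End Network.

(** * Threshold tests and one node's part in them *)

(** A test compares the total gain with the total loss; keeping the two parts of
    a signed weight apart keeps all counts in [nat]. *)
Record test (X : Type) := Test {
  gain : X -> nat;
  loss : X -> nat;
  strict : bool
}.

(** The opposite test: reversing both the sign and the strictness negates the
    outcome. *)
Definition dual X (T : test X) := Test (loss T) (gain T) (~~ strict T).

Definition passes X (T : test X) n (x : {ffun 'I_n -> X}) : bool :=
  let g := \sum_i gain T (x i) in
  let l := \sum_i loss T (x i) in
  if strict T then l < g else l <= g.

Lemma passes_dual X (T : test X) n (x : {ffun 'I_n -> X}) :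
  passes (dual T) x = ~~ passes T x.
Proof. by rewrite /passes /=; case: (strict T) => /=; rewrite -?leqNgt -?ltnNge. Qed.

Section Cell.
Variables B d : nat.

(** What a node of degree [d] stores for one test: chips, debt, mark, and one
    rotor for each kind of walker. The bound on chips holds because a node with
    fewer than [d] of them has fewer than [2 d] after a round, and a node with
    more cannot gain. The two rotors are separate since a rotor that other
    walkers also advance might never point to some port when chips use it. *)
Definition cell : finType :=
  ('I_(B + d.*2).+1 * 'I_B.+1 * bool * 'I_d.+1 * 'I_d.+1)%type.

Implicit Type a : cell.

Definition chips a : nat := a.1.1.1.1.
Definition debt a : nat := a.1.1.1.2.
Definition mark a : bool := a.1.1.2.
Definition chip_rotor a : nat := a.1.2.
Definition mark_rotor a : nat := a.2.

Definition active a := (0 < chips a) || mark a.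

Definition make_cell (c b : nat) (m : bool) (r s : nat) : cell :=
  (inord c, inord b, m, inord r, inord s).

(** One chip through the rotor port, or one through every port if there are
    enough; either way the rotor port is served whenever there is a chip, which
    is all that [walk_dichotomy] asks. *)
Definition sends_chip a (q : nat) : bool :=
  (d <= chips a) || ((0 < chips a) && (chip_rotor a == q)).

Definition sends_mark a (q : nat) : bool := mark a && (mark_rotor a == q).

(** The number [k] and the Boolean [z] stand for the chips and the mark received.
    A mark that was here has left with the outgoing walkers, so a mark present
    afterwards has either arrived or been born; the debt before the round tells
    whether a debt has just been paid off, the occasion for a birth. *)
Definition react (weak : bool) a (k : nat) (z : bool) : cell :=
  let u := chips a - \sum_(q < d) sends_chip a q + k in
  make_cell (u - debt a) (debt a - u)
    [&& weak, debt a <= u & (0 < debt a) || z]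
    (turn d (0 < chips a) (chip_rotor a))
    (turn d (mark a) (mark_rotor a)).

(** A non-strict test starts with a mark at every node without debt, for the
    case that there is no debt at all. *)
Definition init_cell X (T : test X) (x : X) : cell :=
  make_cell (gain T x) (loss T x) (~~ strict T && (loss T x == 0)) 0 0.

Lemma sent_all a : d <= chips a -> \sum_(q < d) sends_chip a q = d.
Proof.
move=> da; rewrite (eq_bigr (fun=> 1)); last by move=> q _; rewrite /sends_chip da.
by rewrite sum1_card card_ord.
Qed.

(** A node never sends more than it has, so the subtraction in [react] is
    exact. *)
Lemma sent_le a : \sum_(q < d) sends_chip a q <= chips a.
Proof.
have [da|ad] := leqP d (chips a); first by rewrite sent_all.
rewrite (eq_bigr (fun q : 'I_d => (0 < chips a) && (chip_rotor a == q) : nat)); last first.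
  by move=> q _; rewrite /sends_chip leqNgt ad.
case: (posnP (chips a)) => [->|a0]; first by rewrite big1.
apply: leq_trans a0; have [rd|dr] := ltnP (chip_rotor a) d.
  rewrite (bigD1 (Ordinal rd)) //= eqxx big1 // => q /negbTE; rewrite -val_eqE /=.
  by rewrite eq_sym => ->.
by rewrite big1 // => q _; rewrite gtn_eqF // (leq_trans (ltn_ord q)).
Qed.

Lemma turn_lt on r : 0 < d -> r < d -> turn d on r < d.
Proof. by move=> d0; rewrite /turn; case: on; rewrite ?ltn_mod. Qed.

Section React.
Variables (weak : bool) (a : cell) (k : nat) (z : bool).
(* Each neighbour sends at most one chip. *)
Hypothesis kd : k <= d.
Let u := chips a - \sum_(q < d) sends_chip a q + k.

(** The stored value is not truncated: a node can receive at most [d] chips,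
    and it has just sent [d] if it had that many. *)
Lemma chips_react : chips (react weak a k z) = u - debt a.
Proof.
rewrite /chips /= inordK // ltnS (leq_trans (leq_subr _ _)) //.
have : chips a <= B + d.*2 by rewrite -ltnS ltn_ord.
have [da|ad] := leqP d (chips a); last by lia.
by rewrite (sent_all da); lia.
Qed.

Lemma debt_react : debt (react weak a k z) = debt a - u.
Proof.
by rewrite /debt /= inordK // (leq_ltn_trans (leq_subr _ _)) // ltn_ord.
Qed.

Lemma mark_react :
  mark (react weak a k z) = [&& weak, debt a <= u & (0 < debt a) || z].
Proof. by []. Qed.

Lemma chip_rotor_react : 0 < d -> chip_rotor a < d ->
  chip_rotor (react weak a k z) = turn d (0 < chips a) (chip_rotor a).
Proof.
by move=> d0 rd; rewrite /chip_rotor /= inordK // ltnS ltnW // turn_lt.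
Qed.

Lemma mark_rotor_react : 0 < d -> mark_rotor a < d ->
  mark_rotor (react weak a k z) = turn d (mark a) (mark_rotor a).
Proof.
by move=> d0 rd; rewrite /mark_rotor /= inordK // ltnS ltnW // turn_lt.
Qed.

End React.

Lemma chips_init X (T : test X) x : gain T x <= B -> chips (init_cell T x) = gain T x.
Proof. by move=> gB; rewrite /chips /= inordK // ltnS (leq_trans gB) ?leq_addr. Qed.

Lemma debt_init X (T : test X) x : loss T x <= B -> debt (init_cell T x) = loss T x.
Proof. by move=> lB; rewrite /debt /= inordK. Qed.

Lemma chip_rotor_init X (T : test X) x : chip_rotor (init_cell T x) = 0.
Proof. by rewrite /chip_rotor /= inordK. Qed.

Lemma mark_rotor_init X (T : test X) x : mark_rotor (init_cell T x) = 0.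
Proof. by rewrite /mark_rotor /= inordK. Qed.

End Cell.

(** * The algorithm *)
Section Machine.
Variables (X Y C : finType) (cut : C -> test X).
Variable decode : {ffun C -> bool} -> option Y.

(** Each cut is tested in two ways: [(c, true)] runs the test of [c] and
    [(c, false)] runs its dual. *)
Definition process : finType := (C * bool)%type.

Definition test_of (p : process) := if p.2 then cut p.1 else dual (cut p.1).

Definition capacity :=
  \max_(p : process) \max_(x : X) maxn (gain (test_of p) x) (loss (test_of p) x).

Lemma capacityP p x :
  gain (test_of p) x <= capacity /\ loss (test_of p) x <= capacity.
Proof.
apply/andP; rewrite -geq_max.
apply: leq_trans (leq_bigmax (F := fun p : process => \max_(x : X) _) p).
exact: (leq_bigmax (F := fun x => maxn (gain (test_of p) x) _) x).
Qed.

Definition msg : finType := {ffun process -> bool * bool}.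

Definition mem (d : nat) : finType :=
  ({ffun process -> cell capacity d} * {ffun C -> bool})%type.

Definition chip_in (p : process) (o : option msg) : bool :=
  if o is Some g then (g p).1 else false.

Definition mark_in (p : process) (o : option msg) : bool :=
  if o is Some g then (g p).2 else false.

Definition init_mem d (x : X) : mem d :=
  ([ffun p => init_cell capacity d (test_of p) x], [ffun => false]).

(** The belief about a cut follows whichever of its two tests was active last.
    The choice made when both are active is immaterial, since one of them falls
    silent. *)
Definition revise d (cells : process -> cell capacity d) (b : {ffun C -> bool}) :
    {ffun C -> bool} :=
  [ffun c => active (cells (c, true)) || ~~ active (cells (c, false)) && b c].

Definition next_mem d (s : mem d) (inbox : seq (option msg)) : mem d :=
  let cells := [ffun p => react (~~ strict (test_of p)) (s.1 p)
      (\sum_(o <- inbox) chip_in p o) (has (mark_in p) inbox)] in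
  (cells, revise cells s.2).

Definition emit d (s : mem d) : d.-tuple (option msg) :=
  [tuple Some [ffun p => (sends_chip (s.1 p) q, sends_mark (s.1 p) q)] | q < d].

(* Kept folded so that [nth_emit] can find the port. *)
Arguments emit : simpl never.

(** The round is played on receipt: the memory written at time [t.+1] has
    absorbed the messages of time [t], and the messages written with it are
    already computed from it. *)
Definition step d (s : state X Y msg (mem d) d) : state X Y msg (mem d) d :=
  let s' := if st_mem s is Some s0 then next_mem s0 (st_msg s)
            else init_mem d (st_init s) in
  State (st_init s) (Some s') (decode s'.2) (emit s').

Lemma step_init d (s : state X Y msg (mem d) d) : st_init (step s) = st_init s.
Proof. by []. Qed.

Definition machine : algorithm X Y := @Algorithm X Y mem msg step step_init.

Section Run.
Variables (n : nat) (N : network n) (x : {ffun 'I_n -> X}).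
Hypothesis n_gt1 : 1 < n.

(** The run with its option types removed: since the messages of a node are a
    function of its memory, the memories alone form a dynamical system. *)
Fixpoint memory_at (t : nat) : forall i, mem (degree N i) :=
  match t with
  | 0 => fun i => init_mem (degree N i) (x i)
  | t'.+1 => fun i => next_mem (memory_at t' i)
      [seq nth None (emit (memory_at t' j)) (position N j i) | j <- neighbours N i]
  end.

Lemma run_machine t i :
  run machine N x t.+1 i =
  State (x i) (Some (memory_at t i)) (decode (memory_at t i).2)
        (emit (memory_at t i)).
Proof.
elim: t i => [//|t IH] i.
have -> : run machine N x t.+2 i = step (State (x i)
    (st_mem (run machine N x t.+1 i)) (st_out (run machine N x t.+1 i))
    (incoming (run machine N x t.+1) i)) by [].
rewrite IH /step /st_mem /st_init /st_msg.
have -> : next_mem (memory_at t i) (incoming (run machine N x t.+1) i) =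
    memory_at t.+1 i => //.
by congr next_mem; apply: eq_map => j; rewrite IH.
Qed.

(** * The dynamics of one test *)
Section Process.
Variable p : process.

Let chips_at t i := chips ((memory_at t i).1 p).
Let debt_at t i := debt ((memory_at t i).1 p).
Let mark_at t i := mark ((memory_at t i).1 p).
Let chip_rotor_at t i := chip_rotor ((memory_at t i).1 p).
Let mark_rotor_at t i := mark_rotor ((memory_at t i).1 p).
Let weak := ~~ strict (test_of p).

Definition chip_moves t i j := edge N i j &&
  sends_chip ((memory_at t i).1 p) (position N i j).
Definition mark_moves t i j := edge N i j &&
  sends_mark ((memory_at t i).1 p) (position N i j).

Let sent t i := \sum_j chip_moves t i j.
Let received t i := \sum_j chip_moves t j i.

Lemma received_le t i : received t i <= degree N i.
Proof.
rewrite /received /degree -sum1_card [leqRHS]big_mkcond leq_sum // => j _.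
rewrite /chip_moves edge_sym -topredE /=.
by case: (edge N i j) => //; exact: leq_b1.
Qed.

Lemma sentE t i :
  \sum_(q < degree N i) sends_chip ((memory_at t i).1 p) q = sent t i.
Proof.
rewrite (big_position N i (fun q => sends_chip ((memory_at t i).1 p) q : nat)).
rewrite big_mkcond /=.
by apply: eq_bigr => j _; rewrite /chip_moves; case: (edge N i j).
Qed.

Lemma nth_emit d (s : mem d) q : q < d -> nth None (emit s) q =
  Some [ffun p => (sends_chip (s.1 p) q, sends_mark (s.1 p) q)].
Proof. by move=> qd; rewrite (nth_mktuple _ _ (Ordinal qd)). Qed.

(** The local rule seen from outside: what a node receives is counted by the
    moves of its neighbours along their edges to it. *)
Lemma cell_at t i : (memory_at t.+1 i).1 p =
  react weak ((memory_at t i).1 p) (received t i) [exists j, mark_moves t j i].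
Proof.
rewrite /= ffunE big_map has_map; congr react.
  rewrite big_neighbours big_mkcond; apply: eq_bigr => j _.
  rewrite /chip_moves edge_sym; case ji: (edge N j i) => //=.
  by rewrite nth_emit ?position_ltn //= ffunE.
apply/hasP/existsP => [[j]|[j /andP[ji mj]]].
  rewrite mem_neighbours => ij /=; rewrite nth_emit ?(position_lt ij) //= ffunE /=.
  by exists j; rewrite /mark_moves edge_sym ij.
move: (ji); rewrite edge_sym => ij; exists j; first by rewrite mem_neighbours.
by rewrite /= nth_emit ?(position_lt ij) //= ffunE.
Qed.

Let inflow t i := chips_at t i - sent t i + received t i.

Lemma chips_atS t i : chips_at t.+1 i = inflow t i - debt_at t i.
Proof. by rewrite /chips_at cell_at chips_react ?received_le // sentE. Qed.

Lemma debt_atS t i : debt_at t.+1 i = debt_at t i - inflow t i.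
Proof. by rewrite /debt_at cell_at debt_react ?received_le // sentE. Qed.

Lemma mark_atS t i : mark_at t.+1 i =
  [&& weak, debt_at t i <= inflow t i
    & (0 < debt_at t i) || [exists j, mark_moves t j i]].
Proof. by rewrite /mark_at cell_at mark_react sentE. Qed.

Lemma chip_rotor_lt t i : chip_rotor_at t i < degree N i.
Proof.
have d0 := degree_gt0 N i n_gt1.
elim: t => [|t IH]; first by rewrite /chip_rotor_at /= ffunE chip_rotor_init.
by rewrite /chip_rotor_at cell_at chip_rotor_react ?turn_lt.
Qed.

Lemma mark_rotor_lt t i : mark_rotor_at t i < degree N i.
Proof.
have d0 := degree_gt0 N i n_gt1.
elim: t => [|t IH]; first by rewrite /mark_rotor_at /= ffunE mark_rotor_init.
by rewrite /mark_rotor_at cell_at mark_rotor_react ?turn_lt.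
Qed.

Lemma chip_rotor_atS t i : chip_rotor_at t.+1 i =
  turn (degree N i) (0 < chips_at t i) (chip_rotor_at t i).
Proof.
rewrite /chip_rotor_at cell_at chip_rotor_react //; first exact: degree_gt0.
exact: chip_rotor_lt.
Qed.

Lemma mark_rotor_atS t i : mark_rotor_at t.+1 i =
  turn (degree N i) (mark_at t i) (mark_rotor_at t i).
Proof.
rewrite /mark_rotor_at cell_at mark_rotor_react //; first exact: degree_gt0.
exact: mark_rotor_lt.
Qed.

Lemma sent_le_chips t i : sent t i <= chips_at t i.
Proof. by rewrite -sentE sent_le. Qed.

(** Chips minus debt is conserved, written without subtraction. Moves only
    exchange chips between nodes, and annihilation takes one unit of each. *)
Lemma balance t : \sum_i chips_at t i + \sum_i loss (test_of p) (x i) =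
                  \sum_i gain (test_of p) (x i) + \sum_i debt_at t i.
Proof.
elim: t => [|t IH].
  congr (_ + _); apply: eq_bigr => i _.
    by rewrite /chips_at /= ffunE chips_init //; have [] := capacityP p (x i).
  by rewrite /debt_at /= ffunE debt_init //; have [] := capacityP p (x i).
have flow : \sum_i sent t i = \sum_i received t i by rewrite exchange_big.
have local : \sum_i chips_at t.+1 i + \sum_i debt_at t i + \sum_i sent t i =
    \sum_i chips_at t i + \sum_i received t i + \sum_i debt_at t.+1 i.
  rewrite -!big_split; apply: eq_bigr => i _ /=.
  by rewrite chips_atS debt_atS /inflow; have := sent_le_chips t i; lia.
by move: IH local; rewrite flow; lia.
Qed.

Lemma debt_settles :
  exists D : 'I_n -> nat, eventually (fun t => forall i, debt_at t i = D i).
Proof.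
have /fin_all_exists[D DP] i : exists d, eventually (fun t => debt_at t i = d).
  by apply: (@eventually_constant _ 0) => t _; rewrite debt_atS leq_subr.
by exists D; apply: eventually_all.
Qed.

Lemma chip_moves_received t i j : chip_moves t i j -> 0 < received t j.
Proof. by move=> ij; rewrite /received (bigD1 i) //= ij. Qed.

(** Once the debts have settled, a chip that arrived at a node in debt would
    lower that debt; so no chip is lost any more. *)
Lemma chips_dichotomy :
  eventually (fun t => forall i, ~~ (0 < chips_at t i)) \/
  forall i, recurrent (fun t => 0 < chips_at t i).
Proof.
apply: (walk_dichotomy chip_rotor_lt chip_rotor_atS).
have [D [T static]] := debt_settles; exists T => t Tt i j ij ci ri.
have rj : 0 < received t j.
  by apply: (@chip_moves_received _ i); rewrite /chip_moves ij /sends_chip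
    -/(chips_at t i) ci -/(chip_rotor_at t i) ri eqxx orbT.
have := debt_atS t j; rewrite !static ?leqW // chips_atS static // /inflow.
by lia.
Qed.

(** Behaviour of the marks once all chips are gone and the debts are constant
    in time. *)
Section Quiet.
Variables (D : 'I_n -> nat) (T : nat).
Hypothesis quiet :
  forall t, T <= t -> forall i, chips_at t i = 0 /\ debt_at t i = D i.

Lemma mark_at_quiet t i : T <= t ->
  mark_at t.+1 i = [&& weak, D i == 0 & [exists j, mark_moves t j i]].
Proof.
move=> Tt; rewrite mark_atS /inflow; have [-> ->] := quiet Tt i.
have -> : received t i = 0.
  rewrite /received big1 // => j _; rewrite /chip_moves /sends_chip.
  rewrite -/(chips_at t j); have [-> _] := quiet Tt j.
  by rewrite leqNgt degree_gt0 // andbF.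
by rewrite leqn0; case: (D i).
Qed.

Definition mark_target t i := nth i (neighbours N i) (mark_rotor_at t i).

Lemma mark_movesE t i j :
  mark_moves t i j = mark_at t i && (mark_target t i == j).
Proof.
rewrite /mark_moves /sends_mark -/(mark_at t i) -/(mark_rotor_at t i).
rewrite andbCA /mark_target /position; congr (_ && _).
have lt := mark_rotor_lt t i; apply/andP/eqP => [[ij /eqP ->]|<-].
  by rewrite nth_index ?mem_neighbours.
rewrite -mem_neighbours mem_nth ?size_tuple //.
by rewrite index_uniq ?size_tuple ?neighbours_uniq.
Qed.

(** From now on every mark comes from a mark, so their number cannot increase;
    once it is constant, no mark is destroyed and no two merge. *)
Lemma marks_settle :
  eventually (fun t => forall i, mark_at t i -> mark_at t.+1 (mark_target t i)).
Proof.
pose M t := [set i | mark_at t i].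
have sub t : T <= t -> M t.+1 \subset mark_target t @: M t.
  move=> Tt; apply/subsetP => j; rewrite inE mark_at_quiet //.
  case/and3P=> _ _ /existsP[i]; rewrite mark_movesE => /andP[mi /eqP <-].
  by apply: imset_f; rewrite inE.
have [t /sub/subset_leq_card le|m [U const]] := @eventually_constant (fun t => #|M t|) T.
  exact: leq_trans le (leq_imset_card _ _).
exists (maxn T U) => t; rewrite geq_max => /andP[Tt Ut] i mi.
apply: contraT => mj; suff : #|M t.+1| < #|M t| by rewrite !const ?leqW ?ltnn.
apply: leq_trans (leq_imset_card (mark_target t) _); apply: proper_card.
apply/properP; split; first exact: sub.
by exists (mark_target t i); rewrite ?imset_f ?inE.
Qed.

Lemma marks_dichotomy :
  eventually (fun t => forall i, ~~ mark_at t i) \/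
  forall i, recurrent (fun t => mark_at t i).
Proof.
apply: (walk_dichotomy mark_rotor_lt mark_rotor_atS).
have [U settled] := marks_settle; exists U => t Ut i j ij mi ri.
by have := settled t Ut i mi; rewrite /mark_target ri nth_index ?mem_neighbours.
Qed.

(** Recurrent marks would visit the node in debt, where none can stay. *)
Lemma marks_vanish j : 0 < D j -> eventually (fun t => forall i, ~~ mark_at t i).
Proof.
move=> Dj; have [//|/(_ j T.+1)[[//|t] Tt]] := marks_dichotomy.
by rewrite mark_at_quiet // eqn0Ngt Dj andbF.
Qed.

End Quiet.

(** The last debt to disappear leaves a mark behind, and without debt marks can
    only move and merge. *)
Lemma mark_exists t : weak -> (forall i, debt_at t i = 0) -> exists i, mark_at t i.
Proof.
move=> wk; elim: t => [|t IH] d0.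
  exists (Ordinal (ltnW n_gt1)); move: (d0 (Ordinal (ltnW n_gt1))).
  rewrite /mark_at /debt_at /= ffunE debt_init; last by have [] := capacityP p (x (Ordinal (ltnW n_gt1))).
  by rewrite /mark /= => ->; rewrite -/weak wk.
have le i : debt_at t i <= inflow t i.
  by have := d0 i; rewrite debt_atS => /eqP; rewrite subn_eq0.
have [/existsP[i di]|] := boolP [exists i, 0 < debt_at t i].
  by exists i; rewrite mark_atS wk le di.
rewrite negb_exists => /forallP nd.
have [i|i mi] := IH; first by apply/eqP; rewrite eqn0Ngt.
exists (mark_target t i); rewrite mark_atS wk le /=; apply/orP; right.
by apply/existsP; exists i; rewrite mark_movesE mi eqxx.
Qed.

Lemma no_strict_mark t i : ~~ weak -> ~~ mark_at t i.
Proof.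
case: t => [|t] /negbTE wk; last by rewrite mark_atS wk.
by rewrite /mark_at /= ffunE /mark /= -/weak wk.
Qed.

Let active_at t i := active ((memory_at t i).1 p).

(** Activity at a node is the lasting signal that the test succeeds. If chips
    recur everywhere, no debt can have survived, so the sum is positive.
    Otherwise the chips are gone, the sum is minus the surviving debt, and the
    marks decide between zero and negative. *)
Lemma active_spec :
  if passes (test_of p) x then forall i, recurrent (fun t => active_at t i)
  else eventually (fun t => forall i, ~~ active_at t i).
Proof.
have [D [T debtD]] := debt_settles.
have aE t i : active_at t i = (0 < chips_at t i) || mark_at t i by [].
have [[U noc]|busy] := chips_dichotomy; last first.
  have D0 i : D i = 0.
    have [[//|t] Tt] := busy i T.+1; rewrite chips_atS => c.
    by rewrite -(debtD t.+1 (ltnW Tt)) debt_atS; lia.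
  have pass : \sum_i loss (test_of p) (x i) < \sum_i gain (test_of p) (x i).
    have [t Tt c] := busy (Ordinal (ltnW n_gt1)) T.
    have := balance t; rewrite [\sum_i debt_at t i]big1 => [|i _]; last by rewrite debtD.
    by rewrite (bigD1 (Ordinal (ltnW n_gt1))) //=; lia.
  have -> : passes (test_of p) x by rewrite /passes pass ltnW //; case: (strict _).
  by move=> i W; have [t Wt c] := busy i W; exists t => //; rewrite aE c.
have quiet t : maxn T U <= t -> forall i, chips_at t i = 0 /\ debt_at t i = D i.
  rewrite geq_max => /andP[Tt Ut] i; split; last exact: debtD.
  by apply/eqP; have := noc t Ut i; rewrite -eqn0Ngt.
have inactive : eventually (fun t => forall i, ~~ mark_at t i) ->
    eventually (fun t => forall i, ~~ active_at t i).
  move=> [W nom]; exists (maxn (maxn T U) W) => t; rewrite geq_max => /andP[TUt Wt] i.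
  by rewrite aE negb_or nom // andbT; have [-> _] := quiet t TUt i.
have := balance (maxn T U); rewrite big1 => [|i _]; last first.
  by have [-> _] := quiet _ (leqnn _) i.
rewrite [X in _ = _ + X](eq_bigr D) => [|i _]; last by have [_ ->] := quiet _ (leqnn _) i.
rewrite add0n => bal.
have [/existsP[j Dj]|] := boolP [exists j, 0 < D j].
  have -> : passes (test_of p) x = false.
    have : 0 < \sum_i D i by rewrite (bigD1 j) //= addn_gt0 Dj.
    rewrite /passes bal; move: (\sum_i D i) (\sum_i _) => d g d0.
    by case: (strict _); apply/negbTE; rewrite -?ltnNge -?leqNgt; lia.
  exact: inactive (marks_vanish quiet Dj).
rewrite negb_exists => /forallP D0.
have {}D0 i : D i = 0 by apply/eqP; rewrite eqn0Ngt.
rewrite [\sum_i D i]big1 // addn0 in bal; rewrite /passes bal ltnn leqnn.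
case st: (strict (test_of p)).
  by apply: inactive; exists 0 => t _ i; apply: no_strict_mark; rewrite /weak st.
have wk : weak by rewrite /weak st.
have [[W nom]|mk] := marks_dichotomy quiet; last first.
  by move=> i V; have [t Vt m] := mk i V; exists t => //; rewrite aE m orbT.
have [|i] := @mark_exists (maxn (maxn T U) W) wk.
  by move=> i; have [_ ->] := quiet (maxn (maxn T U) W) (leq_maxl _ _) i.
by rewrite (negbTE (nom _ _ i)) // leq_maxr.
Qed.

End Process.

Lemma opinionS t i c : (memory_at t.+1 i).2 c =
  active ((memory_at t.+1 i).1 (c, true)) ||
  ~~ active ((memory_at t.+1 i).1 (c, false)) && (memory_at t i).2 c.
Proof. by rewrite [(memory_at t.+1 i).2]/= ffunE. Qed.

(** Of the two tests of a cut one is active infinitely often and the other only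
    finitely often, so the last one heard is the true one. *)
Lemma opinion_settles c :
  eventually (fun t => forall i, (memory_at t i).2 c = passes (cut c) x).
Proof.
have := active_spec (c, false); have := active_spec (c, true).
rewrite /test_of /= passes_dual; case: (passes (cut c) x) => /= up down.
  have [T quiet] := down; apply: eventually_all => i.
  have [[//|u] Tu on] := up i T.+1; exists u.+1; elim=> [//|t IH].
  rewrite leq_eqVlt => /orP[/eqP <-|]; first by rewrite opinionS on.
  rewrite ltnS opinionS => ut; rewrite (IH ut) quiet ?orbT //.
  by apply: leq_trans (ltnW Tu) _; apply: leqW.
have [T quiet] := up; apply: eventually_all => i.
have [[//|u] Tu on] := down i T.+1; exists u.+1; elim=> [//|t IH].
rewrite leq_eqVlt => ut; have Tt : T <= t.+1 by lia.
rewrite opinionS (negbTE (quiet _ Tt i)) orFb.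
case/orP: ut => [/eqP <-|]; first by rewrite on.
by rewrite ltnS => /IH ->; rewrite andbF.
Qed.

Lemma machine_terminates y : decode [ffun c => passes (cut c) x] = Some y ->
  terminates_with machine N x y.
Proof.
move=> dy; have [T settled] := eventually_all opinion_settles.
exists T.+1 => -[//|t] Tt i; rewrite run_machine /= -dy; congr decode.
by apply/ffunP => c; rewrite ffunE; apply: settled.
Qed.

End Run.
End Machine.

(** All tests run side by side in the product automaton. Decoding is partial
    because beliefs can be inconsistent before they settle. *)
Theorem threshold_computable (X Y C : finType) (cut : C -> test X)
    (decode : {ffun C -> bool} -> option Y)
    (f : forall n, {ffun 'I_n -> X} -> Y) :
  (forall n (x : {ffun 'I_n -> X}), 1 < n ->
     decode [ffun c => passes (cut c) x] = Some (f n x)) ->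
  computable f.
Proof.
move=> df; exists (machine cut decode) => n n1 N x.
exact: machine_terminates (df n x n1).
Qed.

(** * Interval averaging *)
Section IntervalAverage.
Import Order.TTheory GRing.Theory Num.Theory.
Local Open Scope ring_scope.
Variable K : nat.

(** The cuts just below ([true]) and just above ([false]) an integer, as in
    [BSide]. *)
Definition endpoint : finType := ('I_K.+1 * bool)%type.

Definition itv_end (c : endpoint) : itv_bound rat := BSide c.2 (c.1 : nat)%:R.

Definition above (c : endpoint) : test 'I_K.+1 :=
  Test (fun v : 'I_K.+1 => v - c.1)%N (fun v : 'I_K.+1 => c.1 - v)%N (~~ c.2).

(** Truncated differences suffice: [v - c] and [c - v] are the positive and
    negative parts, and their difference sums to the total minus [c * n]. *)
Lemma passes_above n (x : {ffun 'I_n -> 'I_K.+1}) c : (1 < n)%N ->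
  passes (above c) x =
  if c.2 then (c.1 : nat)%:R <= average x else (c.1 : nat)%:R < average x.
Proof.
move=> n1; rewrite /average ler_pdivlMr ?ltr_pdivlMr ?ltr0n ?(ltnW n1) //.
rewrite -natr_sum -natrM ltr_nat ler_nat.
have bal : (\sum_i (x i - c.1) + c.1 * n = \sum_i (c.1 - x i) + \sum_i x i)%N.
  rewrite -[X in (_ * X)%N]card_ord mulnC -sum_nat_const -!big_split /=.
  by apply: eq_bigr => i _; lia.
rewrite /passes /above /=; case: c.2 bal => /=; lia.
Qed.

(** An interval contains the average exactly when the average is above its left
    end and not above its right end. *)
Definition agrees (b : {ffun endpoint -> bool}) (y : output K) : bool :=
  [exists c1, exists c2,
    [&& ssval y == Interval (itv_end c1) (itv_end c2), b c1 & ~~ b c2]].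

Lemma unit_interval_ends (I : interval rat) : I \in unit_intervals K ->
  exists c1 c2, I = Interval (itv_end c1) (itv_end c2).
Proof.
rewrite mem_cat => /orP[] /mapP[k]; rewrite mem_iota add0n => /andP[_ kK] ->.
  by exists (Ordinal kK, true), (Ordinal kK, false).
by exists (Ordinal (leqW kK), false), (Ordinal (kK : (k.+1 < K.+1)%N), true).
Qed.

Lemma agreesE n (x : {ffun 'I_n -> 'I_K.+1}) y : (1 < n)%N ->
  agrees [ffun c => passes (above c) x] y = (average x \in ssval y).
Proof.
move=> n1.
have memE c1 c2 : (average x \in Interval (itv_end c1) (itv_end c2)) =
    passes (above c1) x && ~~ passes (above c2) x.
  rewrite !passes_above // in_itv; case: c1 c2 => [k1 b1] [k2 b2] /=.
  by case: b1; case: b2; rewrite -?ltNge -?leNgt.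
apply/existsP/idP => [[c1 /existsP[c2 /and3P[/eqP ->]]]|].
  by rewrite !ffunE memE => -> ->.
have [c1 [c2 yE]] := unit_interval_ends (valP y); rewrite yE memE => pp.
exists c1; apply/existsP; exists c2; rewrite !ffunE pp andbT; exact/eqP.
Qed.

End IntervalAverage.

Theorem theorem4p1 (K : nat) :
  computable (fun (n : nat) (x : {ffun 'I_n -> 'I_K.+1}) => interval_average x).
Proof.
apply: (threshold_computable (cut := @above K)
  (decode := fun b => [pick y | agrees b y])) => n x n1.
have avg := xchooseP (average_exists x).
case: pickP => [y|/(_ (interval_average x))]; rewrite agreesE ?avg // => ry.
have [z [_ uniq_z]] := average_unique x.
by rewrite -(uniq_z _ ry) /interval_average -(uniq_z _ avg).
Qed.
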